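(* Let $s=\sqrt[4]{1/5}$, $$\beta=\frac{2\sqrt2\,s^2}{1-2s^2},\quad \gamma=\frac{4\sqrt2}{5s(1-2s^2)},\quad \delta=\frac{60s^4-19}{50s^2(2s^2-1)^2},\quad K=\frac{2}{5s(1-2s^2)}\approx 5.665658792.$$ For $a\in[0,1]$ set $\eta(a)=\exp\left[i\left(\frac{\pi}{4}+\beta a\right)\right]$, $$\chi_1(a)=a+(s+Ka^2)\exp\left[i\left(\tfrac{\pi}{4}+\gamma a+\delta a^2\right)\right],\quad \chi_2(a)=a+(s+Ka^2)\exp\left[i\left(\tfrac{3\pi}{4}+\gamma a-\delta a^2\right)\right],$$ and define $$q_a(z)=(z-a)(z-\eta(a))(z-i\eta(a))\left[z-\overline{\eta(a)}\right]\left[z+i\overline{\eta(a)}\right]\in S_5,$$ $$s_a(z)=5(z-\chi_1(a))(z-\chi_2(a))\left[z-\overline{\chi_1(a)}\right]\left[z-\overline{\chi_2(a)}\right].$$ Then for all sufficiently small $a>0$ one has $$\Delta(q_a,z^5+z)=\mathcal{O}(a)\quad\text{and}\quad\Delta\left(\frac{q_a'}{5},\frac{s_a}{5}\right)=\mathcal{O}(a^3),$$ so that $d(q_a)=|q_a|_a=s+Ka^2+\mathcal{O}(a^3)$ (the $\mathcal{O}$-terms being understood as $a\to0^+$). In particular, the polynomial $z^5+z$ is not locally maximal for Sendov's conjecture.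
   Context: $S_n$ is the set of monic complex polynomials of degree $n\ge2$ having all their zeros in the closed unit disk. $Z(f)$ denotes the zero set of $f$. For $p\in S_n$ and $\alpha\in\mathbf{C}$, $|p|_\alpha=\min_{w\in Z(p')}|\alpha-w|$ and $d(p)=\max_{z\in Z(p)}\min_{w\in Z(p')}|z-w|$. For monic polynomials $p(z)=\prod_{i=1}^n(z-z_i)$ and $q(z)=\prod_{i=1}^n(z-\zeta_i)$ of the same degree $n$, $\Delta(p,q)=\min_{\sigma\in\Sigma_n}\max_{1\le i\le n}|z_i-\zeta_{\sigma(i)}|$, where $\Sigma_n$ is the symmetric group on $n$ elements. A polynomial $p\in S_n$ is called locally maximal for Sendov's conjecture if there exists $\varepsilon>0$ such that $d(q)\le d(p)$ for every $q\in S_n$ with $\Delta(q,p)<\varepsilon$. Here $q_a'$ denotes the derivative of $q_a$ with respect to $z$. *)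

(* Defs.v *)
From HB Require Import structures.
From mathcomp Require Import all_boot all_order all_algebra all_fingroup.
From mathcomp Require Import all_classical all_reals all_analysis.
From mathcomp Require Export complex.
Set Implicit Arguments.
Unset Strict Implicit.
Unset Printing Implicit Defensive.
Import Order.TTheory GRing.Theory Num.Theory.
Import ComplexField.Normc.
Local Open Scope ring_scope.
Local Open Scope complex_scope.

(* Both are 0 on the empty sequence; below they are only meaningful on
   nonempty ones. *)
Definition seq_min (R : realType) (s : seq R) : R :=
  \big[Num.min/head 0 s]_(x <- s) x.
Definition seq_max (R : realType) (s : seq R) : R :=
  \big[Num.max/head 0 s]_(x <- s) x.

(* The zeros of p listed with multiplicity, in an arbitrary order. For p = 0
   the list carries no information. *)
Definition zeros (R : realType) (p : {poly R[i]}) : seq R[i] :=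
  sval (closed_field_poly_normal p).

Definition sendov_class (R : realType) (n : nat) : set {poly R[i]} :=
  [set p | [/\ p \is monic, size p = n.+1 &
            forall z, root p z -> normc z <= 1]]%classic.

(* |p|_alpha; meaningful when deg p >= 2, so that p^`() has zeros. *)
Definition crit_dist (R : realType) (p : {poly R[i]}) (alpha : R[i]) : R :=
  seq_min [seq normc (alpha - w) | w <- zeros p^`()].

Definition sendov_d (R : realType) (p : {poly R[i]}) : R :=
  seq_max [seq crit_dist p z | z <- zeros p].

(* For p and q monic of degree n. The orderings chosen by [zeros] are
   immaterial since sigma ranges over all permutations. *)
Definition Delta (R : realType) (n : nat) (p q : {poly R[i]}) : R :=
  seq_min [seq seq_max [seq normc ((zeros p)`_i - (zeros q)`_(sigma i))
                         | i : 'I_n]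
            | sigma : 'S_n].

Definition locally_maximal (R : realType) (n : nat) (p : {poly R[i]}) : Prop :=
  sendov_class n p /\
  exists2 eps : R, 0 < eps &
    forall q, sendov_class n q -> Delta n q p < eps ->
      sendov_d q <= sendov_d p.

Definition expi (R : realType) (t : R) : R[i] := cos t +i* sin t.

Definition s (R : realType) : R := 5^-1 `^ 4^-1.
Definition beta (R : realType) : R :=
  2 * Num.sqrt 2 * s R ^+ 2 / (1 - 2 * s R ^+ 2).
Definition gamma (R : realType) : R :=
  4 * Num.sqrt 2 / (5 * s R * (1 - 2 * s R ^+ 2)).
Definition delta (R : realType) : R :=
  (60 * s R ^+ 4 - 19) / (50 * s R ^+ 2 * (2 * s R ^+ 2 - 1) ^+ 2).
Definition K (R : realType) : R := 2 / (5 * s R * (1 - 2 * s R ^+ 2)).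

Definition eta_ (R : realType) (a : R) : R[i] := expi (pi / 4 + beta R * a).

Definition chi1 (R : realType) (a : R) : R[i] :=
  a%:C + (s R + K R * a ^+ 2)%:C
         * expi (pi / 4 + gamma R * a + delta R * a ^+ 2).
Definition chi2 (R : realType) (a : R) : R[i] :=
  a%:C + (s R + K R * a ^+ 2)%:C
         * expi (3 * pi / 4 + gamma R * a - delta R * a ^+ 2).

Definition q_ (R : realType) (a : R) : {poly R[i]} :=
  ('X - a%:C%:P) * ('X - (eta_ a)%:P) * ('X - ('i * eta_ a)%:P)
  * ('X - ((eta_ a)^*)%:P) * ('X + ('i * (eta_ a)^*)%:P).

Definition s_ (R : realType) (a : R) : {poly R[i]} :=
  5 *: (('X - (chi1 a)%:P) * ('X - (chi2 a)%:P)
        * ('X - ((chi1 a)^*)%:P) * ('X - ((chi2 a)^*)%:P)).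

(* Main.v *)
(* The critical points of z^5 + z lie on the circle of radius s, and the
   constants beta, gamma, delta, K are chosen so that the coefficients of q_a'
   and s_a have the same second order Taylor expansion at a = 0. Since the zeros
   of s_a are separated uniformly in a, the zeros of q_a' lie within O(a^3) of
   them, while the zeros of s_a are at distance exactly s + K a^2 from a. The
   other zeros of q_a have a critical point at distance close to 1 - s < s. All
   the estimates hold at a = 0 as well, where q_0 = z^5 + z, so d(z^5 + z) = s is
   exceeded by d(q_a) for small a > 0. *)
Require Import Defs.
From HB Require Import structures.
From mathcomp Require Import all_boot all_order all_algebra all_fingroup.
From mathcomp Require Import all_classical all_reals all_analysis.
From mathcomp Require Import ring lra.
Set Implicit Arguments.
Unset Strict Implicit.
Unset Printing Implicit Defensive.
Import Order.TTheory GRing.Theory Num.Theory.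
Import numFieldNormedType.Exports.
Import ComplexField.Normc.
Local Open Scope classical_set_scope.
Local Open Scope ring_scope.
Local Open Scope complex_scope.

(** The gain over [s] is only K a^2, so the critical points must be known up to o(a^2): agreement of
    coefficients to first order, with an error O(a^2), could not settle the comparison. No Rouché
    argument is used to pass from coefficients to zeros. For a zero x of [s_ a], |q_a'(x)| / 5 is
    the product of the distances from x to the critical points of [q_ a]; it is O(a^3), and
    separation keeps all factors but one away from 0. The nonreal zeros come in conjugate pairs, so
    all coefficients are real polynomials in the real and imaginary parts of eta and chi, and Taylor
    calculus is needed for real functions only. The relations s^4 = 1/5, w^2 = 2 (with w = sqrt 2)
    and (1 - 2 s^2)(1 + 2 s^2) = 1/5 turn the constants into polynomials in s and w: with b = 4 + 10
    s^2 one gets beta = w b, K = s b and gamma = 2 w K. The Taylor coefficients then have finite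
    normal forms, and their comparison is linear arithmetic. *)

Lemma bigmin_mem (R : realType) (x0 : R) (s : seq R) :
  \big[Num.min/x0]_(x <- s) x \in x0 :: s.
Proof.
elim: s => [|y s IH]; first by rewrite big_nil mem_head.
rewrite big_cons minEle; case: ifP => _; first by rewrite !inE eqxx orbT.
by move: IH; rewrite !inE => /orP[->//|->]; rewrite !orbT.
Qed.

Lemma bigmax_mem (R : realType) (x0 : R) (s : seq R) :
  \big[Num.max/x0]_(x <- s) x \in x0 :: s.
Proof.
elim: s => [|y s IH]; first by rewrite big_nil mem_head.
rewrite big_cons maxEle; case: ifP => _; last by rewrite !inE eqxx orbT.
by move: IH; rewrite !inE => /orP[->//|->]; rewrite !orbT.
Qed.

(** The fold starts from [head 0 s], itself an entry when [s] is nonempty, so the default value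
    never intrudes. *)
Lemma seq_min_mem (R : realType) (s : seq R) : s != [::] -> seq_min s \in s.
Proof.
case: s => // x s _; have := bigmin_mem x (x :: s).
by rewrite /seq_min /= inE => /orP[/eqP ->|//]; rewrite mem_head.
Qed.

Lemma seq_max_mem (R : realType) (s : seq R) : s != [::] -> seq_max s \in s.
Proof.
case: s => // x s _; have := bigmax_mem x (x :: s).
by rewrite /seq_max /= inE => /orP[/eqP ->|//]; rewrite mem_head.
Qed.

Lemma seq_min_le (R : realType) (s : seq R) (x : R) : x \in s -> seq_min s <= x.
Proof.
rewrite /seq_min; elim: s (head 0 s) => // y s IH x0; rewrite big_cons inE.
by move=> /orP[/eqP ->|/IH le]; rewrite ge_min ?lexx ?le ?orbT.
Qed.

Lemma seq_max_ge (R : realType) (s : seq R) (x : R) : x \in s -> x <= seq_max s.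
Proof.
rewrite /seq_max; elim: s (head 0 s) => // y s IH x0; rewrite big_cons inE.
by move=> /orP[/eqP ->|/IH le]; rewrite le_max ?lexx ?le ?orbT.
Qed.

Lemma seq_max_le (R : realType) (s : seq R) (e : R) :
  s != [::] -> (forall x, x \in s -> x <= e) -> seq_max s <= e.
Proof. by move=> s0; apply; exact: seq_max_mem. Qed.

(** * Lists of zeros and the matching distance [Delta] *)

Section Zeros.
Context {R : realType}.
Implicit Types p q : {poly R[i]}.

Lemma zeros_factor p :
  p = lead_coef p *: \prod_(z <- zeros p) ('X - z%:P).
Proof. by rewrite /zeros; case: closed_field_poly_normal. Qed.

Lemma monic_zeros_factor p :
  p \is monic -> p = \prod_(z <- zeros p) ('X - z%:P).
Proof. by move=> /eqP mp; rewrite {1}[p]zeros_factor mp scale1r. Qed.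

Lemma mem_zeros p z : p != 0 -> (z \in zeros p) = root p z.
Proof.
by move=> p0; rewrite [in RHS](zeros_factor p) rootZ ?lead_coef_eq0 // root_prod_XsubC.
Qed.

Lemma size_zeros p : p != 0 -> size (zeros p) = (size p).-1.
Proof.
move=> p0; rewrite [in RHS](zeros_factor p) size_scale ?lead_coef_eq0 //.
by rewrite size_prod_XsubC.
Qed.

Lemma perm_zeros_prod (r : seq R[i]) :
  perm_eq (zeros (\prod_(z <- r) ('X - z%:P))) r.
Proof.
by apply: prod_XsubC_eq; rewrite -monic_zeros_factor // monic_prod_XsubC.
Qed.

Lemma image_ord_neq0 n (T : eqType) (F : 'I_n.+1 -> T) :
  [seq F i | i : 'I_n.+1] != [::].
Proof. by rewrite -size_eq0 size_map size_enum_ord. Qed.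

Lemma Delta_le n p q (sigma : 'S_n.+1) (e : R) :
  (forall i : 'I_n.+1, normc ((zeros p)`_i - (zeros q)`_(sigma i)) <= e) ->
  Delta n.+1 p q <= e.
Proof.
move=> H; set t := [seq normc ((zeros p)`_i - (zeros q)`_(sigma i)) | i : 'I_n.+1].
have le_t : seq_max t <= e.
  by apply: seq_max_le => [|x /fintype.imageP[i _ ->] //]; apply: image_ord_neq0.
by apply: le_trans le_t; apply/seq_min_le/fintype.imageP; exists sigma.
Qed.

Lemma Delta_attained n p q : exists sigma : 'S_n.+1,
  forall i : 'I_n.+1,
    normc ((zeros p)`_i - (zeros q)`_(sigma i)) <= Delta n.+1 p q.
Proof.
have /fintype.imageP[sigma _ E] : Delta n.+1 p q \in
    [seq seq_max [seq normc ((zeros p)`_i - (zeros q)`_(sigma i)) | i : 'I_n.+1]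
       | sigma : 'S_n.+1].
  apply: seq_min_mem; rewrite -size_eq0 size_map -cardE -lt0n.
  by apply/card_gt0P; exists 1%g.
by exists sigma => i; rewrite E; apply/seq_max_ge/fintype.imageP; exists i.
Qed.

Lemma Delta_ge0 n p q : 0 <= Delta n.+1 p q.
Proof.
have [sigma /(_ ord0)] := Delta_attained n p q; apply: le_trans.
by case: (_ - _) => x y; rewrite sqrtr_ge0.
Qed.

Lemma perm_eq_nth_perm n (r t : seq R[i]) : size t = n -> perm_eq r t ->
  exists f : 'S_n, forall i : 'I_n, r`_i = t`_(f i).
Proof.
move=> <- /(@tuple_permP _ _ _ (in_tuple t)) [f E].
exists f => i; rewrite E (nth_map i) ?size_enum_ord // nth_ord_enum.
by rewrite (tnth_nth 0).
Qed.

(** [zeros] may list the factors in any order, so explicit lists are paired index by index. If f and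
    g relate the two outputs of [zeros] to [r] and [t], the permutation f g^-1 realises this
    pairing. *)
Lemma Delta_prod_le n (r t : seq R[i]) (e : R) :
  size r = n.+1 -> size t = n.+1 ->
  (forall i, (i < n.+1)%N -> normc (r`_i - t`_i) <= e) ->
  Delta n.+1 (\prod_(z <- r) ('X - z%:P)) (\prod_(z <- t) ('X - z%:P)) <= e.
Proof.
move=> sr st H.
have [f Ef] := @perm_eq_nth_perm n.+1 _ _ sr (perm_zeros_prod r).
have [g Eg] := @perm_eq_nth_perm n.+1 _ _ st (perm_zeros_prod t).
apply: (@Delta_le _ _ _ (f * g^-1)%g) => i.
by rewrite Ef Eg permM permKV; apply: H.
Qed.

End Zeros.

(** * The modulus, and matching of zeros by separation *)

Section ComplexModulus.
Context {R : realType}.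
Implicit Types x y z : R[i].

Lemma normcD x y : normc (x + y) <= normc x + normc y.
Proof. exact: le_normcD. Qed.

Lemma normc_distC x y : normc (x - y) = normc (y - x).
Proof. by rewrite -(normcN (x - y)) opprB. Qed.

Lemma normc_ge0 x : 0 <= normc x.
Proof. by case: x => a b; rewrite sqrtr_ge0. Qed.

Lemma normc_conj x : normc x^*%C = normc x.
Proof. by case: x => a b; rewrite /= sqrrN. Qed.

Lemma normc_real (a : R) : normc a%:C = `|a|.
Proof. by rewrite /= expr0n addr0 sqrtr_sqr. Qed.

Lemma Re_le_normc x : `|complex.Re x| <= normc x.
Proof. by case: x => a b; rewrite -sqrtr_sqr ler_wsqrtr // lerDl sqr_ge0. Qed.

Lemma Im_le_normc x : `|complex.Im x| <= normc x.
Proof. by case: x => a b; rewrite -sqrtr_sqr ler_wsqrtr // lerDr sqr_ge0. Qed.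

Lemma normc_le_ReIm x : normc x <= `|complex.Re x| + `|complex.Im x|.
Proof.
case: x => a b /=; rewrite -[leRHS]ger0_norm ?addr_ge0 // -sqrtr_sqr.
by rewrite ler_wsqrtr // sqrrD !real_normK ?num_real // lerD2r lerDl mulrn_wge0 ?mulr_ge0.
Qed.

Lemma normc_triangle x y z : normc (x - z) <= normc (x - y) + normc (y - z).
Proof. by apply: le_trans (normcD _ _); rewrite addrA subrK. Qed.

Lemma normc_prod (I : Type) (s : seq I) (P : pred I) (F : I -> R[i]) :
  normc (\prod_(i <- s | P i) F i) = \prod_(i <- s | P i) normc (F i).
Proof. by apply: (big_morph _ (@normcM R)); rewrite normc1. Qed.

Lemma normc_sum (I : Type) (s : seq I) (P : pred I) (F : I -> R[i]) :
  normc (\sum_(i <- s | P i) F i) <= \sum_(i <- s | P i) normc (F i).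
Proof.
elim/big_rec2: _ => [|i y1 y2 _ IH]; first by rewrite normc0.
by apply: le_trans (normcD _ _) _; rewrite lerD2l.
Qed.

Lemma normcX x n : normc (x ^+ n) = normc x ^+ n.
Proof. by elim: n => [|n IH]; rewrite ?normc1 // !exprS normcM IH. Qed.

(* A zero of [p] lies within [c] of each [x] in [r] because [p.[x]] is small;
   by separation this matches the two families bijectively, and the other
   factors of [p.[x]] are then at least [c]. *)
Lemma Delta_separated_le n (p : {poly R[i]}) (r : seq R[i]) (c e : R) :
  p \is monic -> size p = n.+2 -> size r = n.+1 -> uniq r -> 0 < c ->
  {in r &, forall x y, x != y -> 2 * c <= normc (x - y)} ->
  {in r, forall x, normc p.[x] <= e} -> e < c ^+ n.+1 ->
  Delta n.+1 p (\prod_(z <- r) ('X - z%:P)) <= e / c ^+ n.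
Proof.
move=> mp szp szr ur c0 sep small ec.
have szP : size (zeros p) = n.+1 by rewrite size_zeros ?szp // monic_neq0.
have pq := perm_zeros_prod r.
set q := \prod_(z <- r) _ in pq *.
have uQ : uniq (zeros q) by rewrite (perm_uniq pq).
have szQ : size (zeros q) = n.+1 by rewrite (perm_size pq).
have QP (j : 'I_n.+1) : (zeros q)`_j \in r by rewrite -(perm_mem pq) mem_nth ?szQ.
have pE x : normc p.[x] = \prod_(i < n.+1) normc (x - (zeros p)`_i).
  rewrite {1}(monic_zeros_factor mp) horner_prod normc_prod.
  rewrite (big_nth 0) szP big_mkord; apply: eq_bigr => i _.
  by rewrite hornerXsubC.
have near (j : 'I_n.+1) : exists i : 'I_n.+1,
    normc ((zeros q)`_j - (zeros p)`_i) < c.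
  apply: contrapT => /forallNP H.
  have : e < normc p.[(zeros q)`_j].
    apply: lt_le_trans ec _; rewrite pE -[n.+1 in leLHS]card_ord -prodr_const.
    by apply: ler_prod => i _; rewrite ltW //= leNgt; apply/negP/H.
  by rewrite ltNge small.
have /choice [f fP] := near.
have f_inj : injective f.
  move=> j k fjk; apply/val_inj/eqP.
  rewrite -(nth_uniq 0 (s := zeros q)) ?szQ ?(ltn_ord j) ?(ltn_ord k) //.
  apply/negPn/negP => ne; have := sep _ _ (QP j) (QP k) ne.
  apply/negP; rewrite -ltNge.
  apply: le_lt_trans (normc_triangle _ (zeros p)`_(f j) _) _.
  rewrite mulr_natl mulr2n ltrD // normc_distC fjk; exact: fP.
(* [f] goes from the zeros of [q] to those of [p], whereas [Delta n.+1 p q] permutes in the other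
   direction; hence the inverse below. *)
pose sigma := perm f_inj.
have fK k : k = f ((sigma^-1)%g k) by rewrite -{1}[k](permKV sigma) permE.
apply: (@Delta_le _ _ _ _ (sigma^-1)%g) => i.
set j := (sigma^-1)%g i.
rewrite (fK i) -/j.
rewrite normc_distC ler_pdivlMr ?exprn_gt0 //.
apply: le_trans (small _ (QP j)); rewrite pE (bigD1 (f j)) //=.
rewrite ler_wpM2l ?normc_ge0 //.
have -> : c ^+ n = \prod_(k < n.+1 | k != f j) c.
  by rewrite prodr_const cardC1 card_ord.
apply: ler_prod => k nk; rewrite ltW //=.
pose l := (sigma^-1)%g k.
have kE : k = f l by exact: fK.
have njl : (zeros q)`_j != (zeros q)`_l.
  by rewrite nth_uniq ?szQ //; apply: contra nk => /eqP/val_inj ->; rewrite kE.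
have := sep _ _ (QP j) (QP l) njl.
have := normc_triangle (zeros q)`_j (zeros p)`_k (zeros q)`_l.
have := fP l; rewrite -kE (normc_distC (zeros q)`_l); lra.
Qed.

End ComplexModulus.

(** * Taylor remainders of sine and cosine *)

Section TrigTaylor.
Context {R : realType}.

(** Stands in for integration of a Taylor bound. Each use multiplies the bound on the derivative by
    h without gaining a denominator, which is why 1/2 recurs in the remainders below; only their
    order matters. *)
Lemma norm_le_MVT (f df : R -> R) (M h : R) :
  (forall x : R, is_derive x 1 f (df x)) -> f 0 = 0 ->
  (forall x, 0 <= x <= h -> `|df x| <= M) -> 0 <= h -> `|f h| <= M * h.
Proof.
move=> fdf f0 dfM h0.
have cf : {within `[0, h], continuous f}.
  apply: (@derivable_within_continuous R R) => x _.
  by case: (fdf x).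
have [c] := MVT_segment h0 (fun x (_ : x \in `]0, h[%R) => fdf x) cf.
rewrite in_itv /= f0 !subr0 => ch ->.
by rewrite normrM (ger0_norm h0) ler_wpM2r // dfM.
Qed.

Lemma norm_sin_le (h : R) : `|sin h| <= `|h|.
Proof.
wlog h0 : h / 0 <= h => [H|].
  by case: (leP 0 h) => [/H //|/ltW h0]; rewrite -normrN -sinN -(normrN h) H // oppr_ge0.
rewrite (ger0_norm h0) -[leRHS]mul1r.
by apply: (@norm_le_MVT _ cos) => // [|x _]; [exact: sin0|exact: cos_max].
Qed.

(** Half-angle formula: cos h - 1 = - 2 sin(h/2)^2, and |sin(h/2)| is at most |h/2|. *)
Lemma norm_cosB1_le (h : R) : `|cos h - 1| <= h ^+ 2 / 2.
Proof.
have -> : h = (h / 2) *+ 2 by rewrite -mulr_natr divfK // pnatr_eq0.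
set x := h / 2; rewrite cos_mulr2n cos2sin2.
have -> : (1 - sin x ^+ 2) *+ 2 - 1 - 1 = - (2 * sin x ^+ 2) by ring.
rewrite normrN normrM ger0_norm // normrX.
have : `|sin x| ^+ 2 <= `|x| ^+ 2 by rewrite ler_pXn2r ?nnegrE ?norm_sin_le.
rewrite !real_normK ?num_real //.
have -> : (x *+ 2) ^+ 2 / 2 = 2 * x ^+ 2 by field.
lra.
Qed.

Lemma norm_sinB_le (h : R) : `|sin h - h| <= `|h| ^+ 3 / 2.
Proof.
wlog h0 : h / 0 <= h => [H|].
  case: (leP 0 h) => [/H //|/ltW h0].
  have -> : sin h - h = - (sin (- h) - - h) by rewrite sinN; ring.
  by rewrite normrN -(normrN h) H // oppr_ge0.
rewrite (ger0_norm h0) (_ : h ^+ 3 / 2 = h ^+ 2 / 2 * h); last by field.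
apply: (@norm_le_MVT (fun x => sin x - x) (fun x => cos x - 1)) => //.
- by rewrite sin0 subr0.
- move=> x /andP[x0 xh]; apply: le_trans (norm_cosB1_le x) _.
  by rewrite ler_wpM2r // ler_pXn2r ?nnegrE.
Qed.

Lemma norm_cosB_le (h : R) : `|cos h - (1 - h ^+ 2 / 2)| <= `|h| ^+ 4 / 2.
Proof.
wlog h0 : h / 0 <= h => [H|].
  case: (leP 0 h) => [/H //|/ltW h0].
  have -> : h ^+ 2 = (- h) ^+ 2 by ring.
  by rewrite -cosN -(normrN h) H // oppr_ge0.
rewrite (ger0_norm h0) (_ : h ^+ 4 / 2 = h ^+ 3 / 2 * h); last by field.
apply: (@norm_le_MVT (fun x => cos x - (1 - x ^+ 2 / 2)) (fun x => - sin x + x)) => //.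
- move=> x; apply: is_derive_eq; rewrite !scaler0 /=.
  by rewrite /GRing.scale /=; field.
- by rewrite /= cos0; ring.
- move=> x /andP[x0 xh]; rewrite -normrN opprD opprK.
  apply: le_trans (norm_sinB_le x) _.
  by rewrite ler_wpM2r // ger0_norm // ler_pXn2r ?nnegrE.
Qed.

End TrigTaylor.

(** * Calculus of second-order expansions with cubic remainder *)

Section Jets.
Context {R : realType}.
Implicit Types f g : R -> R.

(** The remainder bound is uniform on [0, 1] instead of asymptotic: constants combine under sums and
    products with no neighbourhood to shrink, and the value at 0 is included. *)
Definition jet f (p0 p1 p2 : R) := exists C : R, forall a : R, 0 <= a <= 1 ->
  `|f a - (p0 + p1 * a + p2 * a ^+ 2)| <= C * a ^+ 3.

(** Spares [jet] from recording the sign of its constant: at a = 1 the bound reads |u 1| <= C. *)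
Lemma cubic_bound_ge0 (u : R -> R) (C : R) :
  (forall a : R, 0 <= a <= 1 -> `|u a| <= C * a ^+ 3) -> 0 <= C.
Proof.
move=> /(_ 1); rewrite ler01 lexx expr1n mulr1 => /(_ isT).
exact: le_trans.
Qed.

(** Lets the rules below compute raw coefficients, leaving three algebraic identities with the
    intended ones. *)
Lemma eq_jet f p0 p1 p2 q0 q1 q2 :
  jet f p0 p1 p2 -> p0 = q0 -> p1 = q1 -> p2 = q2 -> jet f q0 q1 q2.
Proof. by move=> + <- <- <-. Qed.

Lemma jet_cst p0 : jet (fun=> p0) p0 0 0.
Proof. by exists 0 => a _; rewrite !mul0r !addr0 subrr normr0. Qed.

Lemma jet_id : jet (fun a => a) 0 1 0.
Proof. by exists 0 => a _; rewrite !mul0r mul1r addr0 add0r subrr normr0. Qed.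

Lemma jetN f p0 p1 p2 :
  jet f p0 p1 p2 -> jet (fun a => - f a) (- p0) (- p1) (- p2).
Proof.
move=> [C H]; exists C => a a01; rewrite -normrN.
have -> : - (- f a - (- p0 + - p1 * a + - p2 * a ^+ 2)) =
    f a - (p0 + p1 * a + p2 * a ^+ 2) by ring.
exact: H.
Qed.

Lemma jetD f g p0 p1 p2 q0 q1 q2 : jet f p0 p1 p2 -> jet g q0 q1 q2 ->
  jet (fun a => f a + g a) (p0 + q0) (p1 + q1) (p2 + q2).
Proof.
move=> [C Hf] [D Hg]; exists (C + D) => a a01; rewrite [leRHS]mulrDl /=.
have -> : f a + g a - (p0 + q0 + (p1 + q1) * a + (p2 + q2) * a ^+ 2) =
    (f a - (p0 + p1 * a + p2 * a ^+ 2)) + (g a - (q0 + q1 * a + q2 * a ^+ 2)).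
  by ring.
by apply: le_trans (ler_normD _ _) _; rewrite lerD ?Hf ?Hg.
Qed.

Lemma quad_le (p0 p1 p2 a : R) : 0 <= a <= 1 ->
  `|p0 + p1 * a + p2 * a ^+ 2| <= `|p0| + `|p1| + `|p2|.
Proof.
move=> /andP[a0 a1]; apply: le_trans (ler_normD _ _) _.
apply: lerD; first (apply: le_trans (ler_normD _ _) _; apply: lerD => //).
  by rewrite normrM ler_piMr // ger0_norm.
by rewrite normrM ler_piMr // normrX exprn_ile1 // ger0_norm.
Qed.

Lemma jetM f g p0 p1 p2 q0 q1 q2 : jet f p0 p1 p2 -> jet g q0 q1 q2 ->
  jet (fun a => f a * g a)
    (p0 * q0) (p0 * q1 + p1 * q0) (p0 * q2 + p1 * q1 + p2 * q0).
Proof.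
move=> [C Hf] [D Hg].
(* With P and Q the quadratic parts, the four groups bound (f - P) Q, P (g - Q), (f - P)(g - Q) and
   the terms of degree 3 and 4 of P Q. The last group is a^3 times a polynomial padded with a zero
   coefficient to fit [quad_le]. *)
exists (C * (`|q0| + `|q1| + `|q2|) + (`|p0| + `|p1| + `|p2|) * D + C * D
  + (`|p1 * q2 + p2 * q1| + `|p2 * q2| + `|0 : R|)) => a a01.
have C0 := cubic_bound_ge0 Hf.
have D0 := cubic_bound_ge0 Hg.
have a3_0 : 0 <= a ^+ 3 by rewrite exprn_ge0; case/andP: a01.
have a3_1 : a ^+ 3 <= 1 by case/andP: a01 => ? ?; rewrite exprn_ile1.
have {Hf} := Hf a a01; have {Hg} := Hg a a01.
set P := p0 + _ + _; set Q := q0 + _ + _ => Hg Hf.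
have -> : f a * g a - (p0 * q0 + (p0 * q1 + p1 * q0) * a
      + (p0 * q2 + p1 * q1 + p2 * q0) * a ^+ 2) =
    (f a - P) * Q + P * (g a - Q) + (f a - P) * (g a - Q)
    + ((p1 * q2 + p2 * q1) + p2 * q2 * a + 0 * a ^+ 2) * a ^+ 3.
  by rewrite /P /Q; ring.
rewrite [leRHS]mulrDl; apply: le_trans (ler_normD _ _) _; apply: lerD; last first.
  by rewrite normrM (ger0_norm a3_0) ler_wpM2r // quad_le.
rewrite [leRHS]mulrDl; apply: le_trans (ler_normD _ _) _; apply: lerD; last first.
  rewrite normrM; apply: le_trans (ler_pM _ _ Hf Hg) _ => //.
  have -> : C * a ^+ 3 * (D * a ^+ 3) = C * D * a ^+ 3 * a ^+ 3 by ring.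
  by rewrite ler_piMr // mulr_ge0 // mulr_ge0.
rewrite [leRHS]mulrDl; apply: le_trans (ler_normD _ _) _; apply: lerD.
  rewrite normrM mulrAC; apply: ler_pM => //; exact: quad_le.
by rewrite normrM -mulrA; apply: ler_pM => //; exact: quad_le.
Qed.

Lemma jet_lip f p0 p1 p2 : jet f p0 p1 p2 ->
  exists2 L, 0 <= L & forall a : R, 0 <= a <= 1 -> `|f a - p0| <= L * a.
Proof.
move=> [C H]; have C0 := cubic_bound_ge0 H.
exists (C + `|p1| + `|p2|); first by rewrite !addr_ge0.
move=> a a01; have /andP[a0 a1] := a01.
have -> : f a - p0 = f a - (p0 + p1 * a + p2 * a ^+ 2) + (p1 * a + p2 * a ^+ 2) by ring.
have le_a n : a ^+ n.+1 <= a by rewrite exprS ler_piMr // exprn_ile1.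
rewrite !mulrDl -[leRHS]addrA; apply: le_trans (ler_normD _ _) _; apply: lerD.
  by apply: le_trans (H a a01) _; rewrite ler_wpM2l.
apply: le_trans (ler_normD _ _) _; rewrite !normrM (ger0_norm a0) lerD2l.
by rewrite ler_wpM2l // ler_piMr.
Qed.

Lemma jet_near f p0 p1 p2 e : jet f p0 p1 p2 -> 0 < e ->
  \forall a \near (0 : R), 0 <= a -> `|f a - p0| < e.
Proof.
move=> /jet_lip[L L0 HL] e0; near=> a => a0.
have a1 : a <= 1 by near: a; exact: lt_le_nbhsl.
have a_lt : a < e / (L + 1) by near: a; apply: lt_nbhsl; rewrite divr_gt0 ?ltr_wpDl.
apply: le_lt_trans (HL a _) _; first by rewrite a0.
rewrite ltr_pdivlMr ?ltr_wpDl // in a_lt.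
by apply: le_lt_trans a_lt; rewrite mulrC ler_wpM2l // lerDl.
Unshelve. all: by end_near.
Qed.

(** Since h vanishes at 0, |h a| <= L a, so replacing sin h by h costs at most (L a)^3 / 2. *)
Lemma jet_sin (h : R -> R) h1 h2 : jet h 0 h1 h2 -> jet (fun a => sin (h a)) 0 h1 h2.
Proof.
move=> jh; have [L L0 HL] := jet_lip jh; have [C H] := jh.
exists (L ^+ 3 / 2 + C) => a a01; have := HL a a01; rewrite subr0 => ha.
rewrite [leRHS]mulrDl; apply: le_trans (ler_distD (h a) _ _) _.
apply: lerD; last exact: H.
apply: le_trans (norm_sinB_le _) _; rewrite [leRHS]mulrAC -exprMn.
by rewrite ler_wpM2r // ler_pXn2r ?nnegrE // (le_trans _ ha).
Qed.

(** Compares with 1 - h^2 / 2, whose jet comes from [jetM]; the error (L a)^4 / 2 is cubic because a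
    <= 1. *)
Lemma jet_cos (h : R -> R) h1 h2 :
  jet h 0 h1 h2 -> jet (fun a => cos (h a)) 1 0 (- (h1 ^+ 2 / 2)).
Proof.
move=> jh; have [L L0 HL] := jet_lip jh.
have jq : jet (fun a => 1 - h a * h a * 2^-1) 1 0 (- (h1 ^+ 2 / 2)).
  apply: eq_jet (jetD (jet_cst 1) (jetN (jetM (jetM jh jh) (jet_cst _)))) _ _ _; ring.
have [C H] := jq.
exists (L ^+ 4 / 2 + C) => a a01; have := HL a a01; rewrite subr0 => ha.
have /andP[a0 a1] := a01.
rewrite [leRHS]mulrDl; apply: le_trans (ler_distD (1 - h a * h a * 2^-1) _ _) _.
apply: lerD; last exact: H.
rewrite -expr2; apply: le_trans (norm_cosB_le _) _; rewrite [leRHS]mulrAC ler_wpM2r //.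
apply: (@le_trans _ _ ((L * a) ^+ 4)).
  by rewrite ler_pXn2r ?nnegrE // (le_trans _ ha).
by rewrite exprMn ler_wpM2l ?exprn_ge0 // exprS ler_piMl ?exprn_ge0.
Qed.

End Jets.

(** * Polynomial forms and numerical bounds of the constants *)

Section Constants.
Context {R : realType}.
Local Notation s := (s R).
Local Notation w := (Num.sqrt 2 : R).
Local Notation b := (4 + 10 * s ^+ 2).

Lemma s_gt0 : 0 < s.
Proof. by rewrite powR_gt0 // invr_gt0. Qed.

Lemma s_exp4 : s ^+ 4 = 5^-1.
Proof. by rewrite -powR_mulrn ?powR_ge0 // -powRrM mulVf // powRr1 ?invr_ge0. Qed.

Lemma sqrt2_sqr : w ^+ 2 = 2.
Proof. by rewrite sqr_sqrtr. Qed.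

Lemma s_bounds : 33 / 50 < s < 67 / 100.
Proof.
have s0 := s_gt0; apply/andP; split.
  by rewrite -(@ltr_pXn2r _ 4) ?nnegrE ?ltW // s_exp4; lra.
by rewrite -(@ltr_pXn2r _ 4) ?nnegrE ?ltW // s_exp4; lra.
Qed.

Lemma sqrt2_bounds : 141 / 100 < w < 142 / 100.
Proof.
have w0 : 0 <= w by exact: sqrtr_ge0.
have := sqrt2_sqr; move: (Num.sqrt (2 : R)) w0 => x x0 x2.
by apply/andP; split; rewrite -(@ltr_pXn2r _ 2) ?nnegrE // x2; lra.
Qed.

(** Rationalises the denominators: (1 - 2 s^2)(1 + 2 s^2) = 1 - 4 s^4 = 1/5. *)
Lemma inv_1B2sqr : (1 - 2 * s ^+ 2)^-1 = 5 * (1 + 2 * s ^+ 2).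
Proof.
apply: mulr1_eq; transitivity (5 - 20 * s ^+ 4); first by ring.
by rewrite s_exp4; field.
Qed.

Lemma inv_s : s^-1 = 5 * s ^+ 3.
Proof.
apply: mulr1_eq; transitivity (5 * s ^+ 4); first by ring.
by rewrite s_exp4; field.
Qed.

Lemma betaE : beta R = w * b.
Proof.
rewrite /beta inv_1B2sqr; transitivity (w * (10 * s ^+ 2 + 20 * s ^+ 4)); first by ring.
by rewrite s_exp4; field.
Qed.

Lemma gammaE : gamma R = 2 * w * s * b.
Proof.
rewrite /gamma invfM invfM inv_1B2sqr inv_s.
transitivity (20 * w * s * (s ^+ 2 + 2 * s ^+ 4)); first by field.
by rewrite s_exp4; field.
Qed.

Lemma deltaE : delta R = - 14 - 63 / 2 * s ^+ 2.
Proof.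
rewrite /delta invfM -exprVn -[2 * s ^+ 2 - 1]opprB invrN inv_1B2sqr sqrrN invfM -exprVn inv_s.
transitivity ((30 * s ^+ 4 - 19 / 2) * s ^+ 4 * 25 * s ^+ 2
  * (1 + 4 * s ^+ 2 + 4 * s ^+ 4)); first by field.
rewrite s_exp4; transitivity (- (63 / 2) * s ^+ 2 - 70 * s ^+ 4); first by field.
by rewrite s_exp4; field.
Qed.

Lemma KE : K R = s * b.
Proof.
rewrite /K invfM invfM inv_1B2sqr inv_s.
transitivity (10 * s * (s ^+ 2 + 2 * s ^+ 4)); first by field.
by rewrite s_exp4; field.
Qed.

Lemma ler_sqr_sub_sqr (c x y : R) : 0 <= x ^+ 2 - c -> 0 <= x -> x <= y ->
  (x ^+ 2 - c) ^+ 2 <= (y ^+ 2 - c) ^+ 2.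
Proof.
move=> xc x0 xy; have y0 := le_trans x0 xy.
have xy2 : x ^+ 2 - c <= y ^+ 2 - c by rewrite lerD2r ler_pXn2r ?nnegrE.
by rewrite ler_pXn2r ?nnegrE // (le_trans xc).
Qed.

(** K is algebraic: K^2 = 16 + 36 s^2, so (K^2 - 16)^2 = 1296/5. The map x -> (x^2 - 16)^2 increases
    once x >= 4, so it suffices to evaluate it at the rational end points [l] and [v], at distance
    10^-8 on either side of the decimal value. *)
Lemma K_approx :
  `|K R - (5 + 665 / 10 ^+ 3 + 658 / 10 ^+ 6 + 792 / 10 ^+ 9)| < 10 ^- 8.
Proof.
have s0 := s_gt0.
have K0 : 0 < K R by rewrite KE mulr_gt0 // ltr_wpDr // mulr_ge0 // exprn_ge0 // ltW.
have KK : K R ^+ 2 = 16 + 36 * s ^+ 2.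
  rewrite KE; transitivity (16 * s ^+ 2 + 80 * s ^+ 4 + 100 * s ^+ 2 * s ^+ 4); first by ring.
  by rewrite s_exp4; field.
have KKK : (K R ^+ 2 - 16) ^+ 2 = 1296 / 5.
  by rewrite KK; transitivity (1296 * s ^+ 4); [ring|rewrite s_exp4].
set l : R := 5 + 665 / 10 ^+ 3 + 658 / 10 ^+ 6 + 782 / 10 ^+ 9.
set v : R := 5 + 665 / 10 ^+ 3 + 658 / 10 ^+ 6 + 802 / 10 ^+ 9.
have l5 : 5 < l by rewrite /l; lra.
have v5 : 5 < v by rewrite /v; lra.
have s2 : 0 <= s ^+ 2 by exact: sqr_ge0.
have lK : l < K R.
  rewrite ltNge; apply/negP => Kl.
  have l2 : (l ^+ 2 - 16) ^+ 2 < 1296 / 5 by rewrite /l; lra.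
  have K16 : 0 <= K R ^+ 2 - 16 by rewrite KK; lra.
  have := ler_sqr_sub_sqr K16 (ltW K0) Kl; lra.
have vK : K R < v.
  rewrite ltNge; apply/negP => vK.
  have v2 : 1296 / 5 < (v ^+ 2 - 16) ^+ 2 by rewrite /v; lra.
  have v16 : 0 <= v ^+ 2 - 16 by nra.
  have v0 : 0 < v by lra.
  have := ler_sqr_sub_sqr v16 (ltW v0) vK; lra.
rewrite ltr_norml; move: (K R) lK vK => k; rewrite /l /v; clear=> lK vK.
apply/andP; split; lra.
Qed.


Lemma cos_piquarter : cos (pi / 4) = w / 2.
Proof.
rewrite -atan1 cos_atan expr1n; apply: mulr1_eq.
by rewrite mulrA -expr2 sqrt2_sqr divff.
Qed.

Lemma sin_piquarter : sin (pi / 4) = w / 2.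
Proof.
have := tan_piquarter R; rewrite /tan cos_piquarter => /(canRL (divfK _)) -> //.
by rewrite mul1r.
Qed.

End Constants.

(** * Expansions of the zeros and of the coefficients *)

Section JetsOfZeros.
Context {R : realType}.
Local Notation s := (s R).
Local Notation w := (Num.sqrt 2 : R).
Local Notation Re := complex.Re.
Local Notation Im := complex.Im.

(** Here and for chi the constant angle is split off because [jet_sin] and [jet_cos] want an
    argument vanishing at 0. In the formulas for chi, a^2 is written [a * a], the shape that [jetM]
    produces. *)
Lemma Re_eta (a : R) : Re (eta_ a) = w / 2 * (cos (beta R * a) - sin (beta R * a)).
Proof. by rewrite /= cosD cos_piquarter sin_piquarter mulrBr. Qed.

Lemma Im_eta (a : R) : Im (eta_ a) = w / 2 * (cos (beta R * a) + sin (beta R * a)).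
Proof. by rewrite /= sinD cos_piquarter sin_piquarter mulrDr. Qed.

Lemma Re_chi1 (a : R) : Re (chi1 a) = a + (s + K R * (a * a)) *
  (w / 2 * (cos (gamma R * a + delta R * (a * a)) - sin (gamma R * a + delta R * (a * a)))).
Proof.
by rewrite /chi1 /= mul0r subr0 -!expr2 -addrA cosD cos_piquarter sin_piquarter -mulrBr.
Qed.

Lemma Im_chi1 (a : R) : Im (chi1 a) = (s + K R * (a * a)) *
  (w / 2 * (cos (gamma R * a + delta R * (a * a)) + sin (gamma R * a + delta R * (a * a)))).
Proof.
rewrite /chi1 /= mul0r addr0 add0r -!expr2 -addrA sinD cos_piquarter sin_piquarter.
by rewrite -mulrDr.
Qed.

Lemma Re_chi2 (a : R) : Re (chi2 a) = a - (s + K R * (a * a)) *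
  (w / 2 * (cos (gamma R * a - delta R * (a * a)) + sin (gamma R * a - delta R * (a * a)))).
Proof.
have E : 3 * pi / 4 = pi / 4 + pi / 2 :> R by field.
rewrite /chi2 /= mul0r subr0 E -!expr2 -addrA [_ + pi / 2 + _]addrAC cosDpihalf.
by rewrite sinD cos_piquarter sin_piquarter -mulrDr mulrN.
Qed.

Lemma Im_chi2 (a : R) : Im (chi2 a) = (s + K R * (a * a)) *
  (w / 2 * (cos (gamma R * a - delta R * (a * a)) - sin (gamma R * a - delta R * (a * a)))).
Proof.
have E : 3 * pi / 4 = pi / 4 + pi / 2 :> R by field.
rewrite /chi2 /= mul0r addr0 add0r E -!expr2 -addrA [_ + pi / 2 + _]addrAC sinDpihalf.
by rewrite cosD cos_piquarter sin_piquarter -mulrBr.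
Qed.

Lemma eq_fun_jet (f g : R -> R) p0 p1 p2 : f =1 g -> jet g p0 p1 p2 -> jet f p0 p1 p2.
Proof. by move=> fg [C H]; exists C => a; rewrite fg; exact: H. Qed.

(* Normal forms modulo s^4 = 1/5 and w^2 = 2 of all the monomials that occur below,
   which makes the identities between jets linear, hence accessible to [lra]. *)
Lemma sw_monomials :
  [/\ s ^+ 4 = 5^-1, s ^+ 6 = s ^+ 2 / 5, s ^+ 8 = 25^-1 &
   [/\ w * s ^+ 4 = w / 5, w * s ^+ 5 = w * s / 5, w * s ^+ 7 = w * s ^+ 3 / 5 &
     [/\ w ^+ 2 = 2, w ^+ 2 * s ^+ 2 = 2 * s ^+ 2, w ^+ 2 * s ^+ 4 = 2 / 5,
       w ^+ 2 * s ^+ 6 = 2 * s ^+ 2 / 5 &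
     [/\ w ^+ 3 = 2 * w, w ^+ 3 * s = 2 * w * s,
       w ^+ 3 * s ^+ 2 = 2 * w * s ^+ 2, w ^+ 3 * s ^+ 3 = 2 * w * s ^+ 3 &
     [/\ w ^+ 3 * s ^+ 4 = 2 * w / 5,
       w ^+ 3 * s ^+ 5 = 2 * w * s / 5 & w ^+ 3 * s ^+ 7 = 2 * w * s ^+ 3 / 5]]]]].
Proof.
have w2 : w ^+ 2 = 2 := sqrt2_sqr; have s4 := @s_exp4 R.
have w3 : w ^+ 3 = 2 * w by rewrite exprSr w2.
have s5 : s ^+ 5 = s / 5 by rewrite exprSr s4 mulrC.
have s6 : s ^+ 6 = s ^+ 2 / 5 by rewrite (exprD s 4 2) s4 mulrC.
have s7 : s ^+ 7 = s ^+ 3 / 5 by rewrite (exprD s 4 3) s4 mulrC.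
have s8 : s ^+ 8 = 25^-1 by rewrite (exprM s 4 2) s4; field.
by rewrite w3 w2 s4 s5 s6 s7 s8; do !split; field.
Qed.

(** Once w and s are variables, the monomials listed in [sw_monomials] are atoms for [lra], and the
    relations between them are linear equations. *)
Ltac reduce_sw :=
  rewrite ?betaE ?gammaE ?deltaE ?KE;
  have := sw_monomials; move: (Num.sqrt (2 : R)) (Defs.s R) => w s;
  move=> [? ? ? [? ? ? [? ? ? ? [? ? ? ? [? ? ?]]]]]; lra.

Lemma jet_linear (c : R) : jet (fun a => c * a) 0 c 0.
Proof. by apply: eq_jet (jetM (jet_cst c) jet_id) _ _ _; ring. Qed.

Lemma jet_quadratic (c d : R) : jet (fun a => c * a + d * (a * a)) 0 c d.
Proof.
by apply: eq_jet (jetD (jet_linear c) (jetM (jet_cst d) (jetM jet_id jet_id))) _ _ _; ring.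
Qed.

Lemma jet_quadraticN (c d : R) : jet (fun a => c * a - d * (a * a)) 0 c (- d).
Proof.
by apply: eq_jet (jetD (jet_linear c) (jetN (jetM (jet_cst d) (jetM jet_id jet_id)))) _ _ _; ring.
Qed.

Lemma jet_radius : jet (fun a => s + K R * (a * a)) s 0 (K R).
Proof.
by apply: eq_jet (jetD (jet_cst s) (jetM (jet_cst (K R)) (jetM jet_id jet_id))) _ _ _; ring.
Qed.

(** With b = 4 + 10 s^2, the coefficients are - w beta / 2 = - b and - w beta^2 / 4 = - w b^2 / 2,
    where b^2 = 36 + 80 s^2 modulo s^4 = 1/5. *)
Lemma jet_Re_eta : jet (fun a => Re (eta_ a)) (w / 2) (- (4 + 10 * s ^+ 2))
  (- (w * (18 + 40 * s ^+ 2))).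
Proof.
apply: (eq_fun_jet Re_eta).
have jh := jet_linear (beta R).
by apply: eq_jet (jetM (jet_cst _) (jetD (jet_cos jh) (jetN (jet_sin jh)))) _ _ _; reduce_sw.
Qed.

Lemma jet_Im_eta : jet (fun a => Im (eta_ a)) (w / 2) (4 + 10 * s ^+ 2)
  (- (w * (18 + 40 * s ^+ 2))).
Proof.
apply: (eq_fun_jet Im_eta).
have jh := jet_linear (beta R).
by apply: eq_jet (jetM (jet_cst _) (jetD (jet_cos jh) (jet_sin jh))) _ _ _; reduce_sw.
Qed.

Lemma jet_Re_chi1 : jet (fun a => Re (chi1 a)) (w * s / 2) (- 3 - 8 * s ^+ 2)
  (- (23 * w * s + 205 / 4 * (w * s ^+ 3))).
Proof.
apply: (eq_fun_jet Re_chi1).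
have jh := jet_quadratic (gamma R) (delta R).
by apply: eq_jet (jetD jet_id (jetM jet_radius (jetM (jet_cst _)
  (jetD (jet_cos jh) (jetN (jet_sin jh)))))) _ _ _; reduce_sw.
Qed.

Lemma jet_Im_chi1 : jet (fun a => Im (chi1 a)) (w * s / 2) (4 + 8 * s ^+ 2)
  (- (37 * w * s + 331 / 4 * (w * s ^+ 3))).
Proof.
apply: (eq_fun_jet Im_chi1).
have jh := jet_quadratic (gamma R) (delta R).
by apply: eq_jet (jetM jet_radius (jetM (jet_cst _)
  (jetD (jet_cos jh) (jet_sin jh)))) _ _ _; reduce_sw.
Qed.

Lemma jet_Re_chi2 : jet (fun a => Re (chi2 a)) (- (w * s / 2)) (- 3 - 8 * s ^+ 2)
  (23 * w * s + 205 / 4 * (w * s ^+ 3)).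
Proof.
apply: (eq_fun_jet Re_chi2).
have jh := jet_quadraticN (gamma R) (delta R).
by apply: eq_jet (jetD jet_id (jetN (jetM jet_radius (jetM (jet_cst _)
  (jetD (jet_cos jh) (jet_sin jh)))))) _ _ _; reduce_sw.
Qed.

Lemma jet_Im_chi2 : jet (fun a => Im (chi2 a)) (w * s / 2) (- 4 - 8 * s ^+ 2)
  (- (37 * w * s + 331 / 4 * (w * s ^+ 3))).
Proof.
apply: (eq_fun_jet Im_chi2).
have jh := jet_quadraticN (gamma R) (delta R).
by apply: eq_jet (jetM jet_radius (jetM (jet_cst _)
  (jetD (jet_cos jh) (jetN (jet_sin jh))))) _ _ _; reduce_sw.
Qed.

(** Constant term of the real quadratic with roots z and its conjugate; free of square roots, so
    that [jetD] and [jetM] apply. *)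
Definition sqr_modulus (z : R[i]) := Re z * Re z + Im z * Im z.

Lemma jet_sqr_chi1 :
  jet (fun a => sqr_modulus (chi1 a)) (s ^+ 2) (w * s) (- 3 - 8 * s ^+ 2).
Proof.
by apply: eq_jet (jetD (jetM jet_Re_chi1 jet_Re_chi1) (jetM jet_Im_chi1 jet_Im_chi1)) _ _ _;
  reduce_sw.
Qed.

Lemma jet_sqr_chi2 :
  jet (fun a => sqr_modulus (chi2 a)) (s ^+ 2) (- (w * s)) (- 3 - 8 * s ^+ 2).
Proof.
by apply: eq_jet (jetD (jetM jet_Re_chi2 jet_Re_chi2) (jetM jet_Im_chi2 jet_Im_chi2)) _ _ _;
  reduce_sw.
Qed.

(* The non-real zeros of [q_ a] are the roots of the two real quadratics
   X^2 - 2 Re(eta) X + 1 and X^2 + 2 Im(eta) X + 1, whose product is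
   X^4 + linc X^3 + quadc X^2 + linc X + 1. *)
Definition linc (a : R) := 2 * (Im (eta_ a) - Re (eta_ a)).
Definition quadc (a : R) := 2 - 4 * (Re (eta_ a) * Im (eta_ a)).

Lemma jet_linc : jet linc 0 (16 + 40 * s ^+ 2) 0.
Proof.
by apply: eq_jet (jetM (jet_cst _) (jetD jet_Im_eta (jetN jet_Re_eta))) _ _ _; ring.
Qed.

Lemma jet_quadc : jet quadc 0 0 (288 + 640 * s ^+ 2).
Proof.
by apply: eq_jet (jetD (jet_cst 2) (jetN (jetM (jet_cst 4) (jetM jet_Re_eta jet_Im_eta))))
  _ _ _; reduce_sw.
Qed.

(* Coefficient of X^k in (q_a' - s_a) / 5, for k < 4. *)
Definition coef_diff (k : nat) (a : R) : R :=
  match k with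
  | 0 => 5^-1 * (1 - a * linc a) - sqr_modulus (chi1 a) * sqr_modulus (chi2 a)
  | 1 => 2 / 5 * (linc a - a * quadc a)
    + 2 * (Re (chi1 a) * sqr_modulus (chi2 a) + Re (chi2 a) * sqr_modulus (chi1 a))
  | 2 => 3 / 5 * (quadc a - a * linc a)
    - (sqr_modulus (chi1 a) + sqr_modulus (chi2 a) + 4 * (Re (chi1 a) * Re (chi2 a)))
  | _ => 4 / 5 * (linc a - a) + 2 * (Re (chi1 a) + Re (chi2 a))
  end.

(** The values of beta, gamma, delta and K enter here, making twelve Taylor coefficients vanish. For
    instance the opposite signs of delta in [chi1] and [chi2] cancel the second-order term of Re
    chi1 + Re chi2, as k = 3 requires. All k >= 3 fall in the last branch of [coef_diff]. *)
Lemma jet_coef_diff k : jet (coef_diff k) 0 0 0.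
Proof.
have jl := jet_linc; have jq := jet_quadc; have j1 := jet_sqr_chi1; have j2 := jet_sqr_chi2.
have jr1 := jet_Re_chi1; have jr2 := jet_Re_chi2; have ji := @jet_id R.
case: k => [|[|[|k]]].
- by apply: eq_jet (jetD (jetM (jet_cst _) (jetD (jet_cst 1) (jetN (jetM ji jl))))
    (jetN (jetM j1 j2))) _ _ _; reduce_sw.
- by apply: eq_jet (jetD (jetM (jet_cst _) (jetD jl (jetN (jetM ji jq))))
    (jetM (jet_cst 2) (jetD (jetM jr1 j2) (jetM jr2 j1)))) _ _ _; reduce_sw.
- by apply: eq_jet (jetD (jetM (jet_cst _) (jetD jq (jetN (jetM ji jl))))
    (jetN (jetD (jetD j1 j2) (jetM (jet_cst 4) (jetM jr1 jr2))))) _ _ _; reduce_sw.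
- by apply: eq_jet (jetD (jetM (jet_cst _) (jetD jl (jetN ji)))
    (jetM (jet_cst 2) (jetD jr1 jr2))) _ _ _; reduce_sw.
Qed.

End JetsOfZeros.

(** * Real factorisations and expansions of the two polynomials *)

Section Polynomials.
Context {R : realType}.
Local Notation s := (s R).
Local Notation w := (Num.sqrt 2 : R).
Local Notation Re := complex.Re.
Local Notation Im := complex.Im.

(** A listing whose order follows the zeros continuously in a, unlike the arbitrary one of
    [zeros]. *)
Definition q_zeros (a : R) : seq R[i] :=
  [:: a%:C; eta_ a; 'i * eta_ a; (eta_ a)^*%C; - ('i * (eta_ a)^*%C)].

Definition s_zeros (a : R) : seq R[i] :=
  [:: chi1 a; chi2 a; (chi1 a)^*%C; (chi2 a)^*%C].

Lemma q_prod (a : R) : q_ a = \prod_(z <- q_zeros a) ('X - z%:P).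
Proof. by rewrite /q_ !big_cons big_nil polyCN opprK mulr1 !mulrA. Qed.

Lemma s_prod (a : R) : 5^-1 *: s_ a = \prod_(z <- s_zeros a) ('X - z%:P).
Proof.
by rewrite /s_ scalerA mulVf ?pnatr_eq0 // scale1r !big_cons big_nil mulr1 !mulrA.
Qed.

Lemma mul_XsubC (z v : R[i]) :
  ('X - z%:P) * ('X - v%:P) = 'X^2 - (z + v)%:P * 'X + (z * v)%:P.
Proof. by rewrite polyCD polyCM; ring. Qed.

Lemma add_conj_Re (z : R[i]) : z + z^*%C = (2 * Re z)%:C.
Proof. by case: z => x y; apply/eqP; rewrite eq_complex /= subrr mulr_natl mulr2n !eqxx. Qed.

Lemma mul_conj_modulus (z : R[i]) : z * z^*%C = (sqr_modulus z)%:C.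
Proof.
case: z => x y; apply/eqP; rewrite eq_complex /= /sqr_modulus /=.
by apply/andP; split; apply/eqP; ring.
Qed.

Lemma sqr_modulus_eta (a : R) : sqr_modulus (eta_ a) = 1.
Proof. by rewrite /sqr_modulus -!expr2; exact: cos2Dsin2. Qed.

(** The number - i conj(eta) is the conjugate of i eta; this sum and the product below are the
    coefficients of the second real quadratic. *)
Lemma add_i_etaJ (a : R) :
  'i * eta_ a + - ('i * (eta_ a)^*%C) = (- (2 * Im (eta_ a)))%:C.
Proof.
by apply/eqP; rewrite eq_complex /=; apply/andP; split; apply/eqP; ring.
Qed.

Lemma mul_i_etaJ (a : R) : 'i * eta_ a * - ('i * (eta_ a)^*%C) = 1.
Proof.
transitivity (- ('i ^+ 2) * (eta_ a * (eta_ a)^*%C)); first by ring.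
by rewrite sqr_i opprK mul1r mul_conj_modulus sqr_modulus_eta.
Qed.

Lemma q_expand (a : R) : q_ a = 'X^5 + (linc a - a)%:C%:P * 'X^4
  + (quadc a - a * linc a)%:C%:P * 'X^3 + (linc a - a * quadc a)%:C%:P * 'X^2
  + (1 - a * linc a)%:C%:P * 'X - a%:C%:P.
Proof.
rewrite q_prod !big_cons big_nil mulr1.
(* Regroups the linear factors by conjugate pairs, so that only real coefficients remain. *)
rewrite [X in _ * X](_ : _ = (('X - (eta_ a)%:P) * ('X - (eta_ a)^*%:P)) *
  (('X - ('i * eta_ a)%:P) * ('X - (- ('i * (eta_ a)^*%C))%:P))); last by ring.
rewrite !mul_XsubC add_conj_Re mul_conj_modulus sqr_modulus_eta add_i_etaJ mul_i_etaJ /linc /quadc.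
move: (Re (eta_ a)) (Im (eta_ a)) => x y.
ring.
Qed.

Lemma q_deriv_horner (a : R) (z : R[i]) : (5^-1 *: (q_ a)^`()).[z] =
  z ^+ 4 + (4 / 5 * (linc a - a))%:C * z ^+ 3 + (3 / 5 * (quadc a - a * linc a))%:C * z ^+ 2
  + (2 / 5 * (linc a - a * quadc a))%:C * z + (5^-1 * (1 - a * linc a))%:C.
Proof.
rewrite q_expand; move: (linc a - a) (quadc a - _) (linc a - _) (1 - _) => c4 c3 c2 c1.
rewrite !poly.derivE !(hornerD, hornerZ, hornerN, hornerM, hornerMn, hornerXn, hornerX, hornerC) /=.
by field.
Qed.

Lemma s_horner (a : R) (z : R[i]) : (5^-1 *: s_ a).[z] =
  (z ^+ 2 - (2 * Re (chi1 a))%:C * z + (sqr_modulus (chi1 a))%:C) *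
  (z ^+ 2 - (2 * Re (chi2 a))%:C * z + (sqr_modulus (chi2 a))%:C).
Proof.
rewrite s_prod !big_cons big_nil mulr1 !hornerM !hornerXsubC -!add_conj_Re -!mul_conj_modulus.
ring.
Qed.

Lemma q_deriv_sub_s (a : R) (z : R[i]) :
  (5^-1 *: (q_ a)^`()).[z] - (5^-1 *: s_ a).[z] =
  \sum_(k < 4) (coef_diff k a)%:C * z ^+ k.
Proof.
rewrite q_deriv_horner s_horner !big_ord_recl big_ord0 /=.
ring.
Qed.

End Polynomials.

(** * Zeros of the derivative and distances to them *)

Section CriticalPoints.
Context {R : realType}.
Implicit Types p q : {poly R[i]}.

Lemma monic_scale_deriv n p : p \is monic -> size p = n.+2 ->
  n.+1%:R^-1 *: p^`() \is monic /\ size (n.+1%:R^-1 *: p^`()) = n.+1.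
Proof.
move=> /monicP mp sp; set r := _ *: _.
have n0 : n.+1%:R != 0 :> R[i] by rewrite pnatr_eq0.
have rn : r`_n = 1.
  rewrite coefZ coef_deriv -mulr_natr.
  by rewrite -[p`_n.+1]/(p`_(n.+2.-1)) -sp -/(lead_coef p) mp mul1r mulVf.
have sr : size r = n.+1.
  apply/eqP; rewrite eqn_leq; apply/andP; split.
    by apply: leq_trans (size_scale_leq _ _) _;
       rewrite -ltnS -sp lt_size_deriv // -size_poly_gt0 sp.
  by rewrite ltnNge; apply/negP => /leq_sizeP/(_ _ (leqnn n))/eqP; rewrite rn oner_eq0.
by split=> //; rewrite monicE /lead_coef sr rn.
Qed.

(** The form in which [Delta] serves distance estimates: an optimal matching moves every zero of
    either polynomial to a zero of the other. *)
Lemma Delta_root n p q : p \is monic -> q \is monic ->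
  size p = n.+2 -> size q = n.+2 ->
  (forall z, root p z -> exists2 w, root q w & normc (z - w) <= Delta n.+1 p q) /\
  (forall w, root q w -> exists2 z, root p z & normc (z - w) <= Delta n.+1 p q).
Proof.
move=> mp mq sp sq; have [f fP] := Delta_attained n p q.
have p0 := monic_neq0 mp; have q0 := monic_neq0 mq.
have szp : size (zeros p) = n.+1 by rewrite size_zeros // sp.
have szq : size (zeros q) = n.+1 by rewrite size_zeros // sq.
split=> [z|v]; rewrite -mem_zeros // => /(nthP 0) [k].
  rewrite szp => kl <-; exists (zeros q)`_(f (Ordinal kl)); last exact: fP (Ordinal kl).
  by rewrite -mem_zeros // mem_nth // szq.
rewrite szq => kl <-; pose j := (f^-1)%g (Ordinal kl).
have fj : f j = Ordinal kl by rewrite permKV.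
exists (zeros p)`_j; last by have := fP j; rewrite fj.
by rewrite -mem_zeros // mem_nth // szp.
Qed.

Lemma crit_dist_le p (alpha z : R[i]) : p^`() != 0 -> root p^`() z ->
  crit_dist p alpha <= normc (alpha - z).
Proof. by move=> p0 pz; apply/seq_min_le/map_f; rewrite mem_zeros. Qed.

Lemma crit_dist_attained p (alpha : R[i]) : (1 < size p^`())%N ->
  exists2 z, root p^`() z & crit_dist p alpha = normc (alpha - z).
Proof.
move=> sp; have p0 : p^`() != 0 by rewrite -size_poly_gt0 ltnW.
have /mapP[z] : crit_dist p alpha \in [seq normc (alpha - w) | w <- zeros p^`()].
  apply: seq_min_mem; rewrite -size_eq0 size_map size_zeros //.
  by case: (size _) sp => [|[]].
by rewrite mem_zeros // => pz ->; exists z.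
Qed.

End CriticalPoints.

(** * Numerical estimates for small a *)

Section SmallParameter.
Context {R : realType}.
Local Notation s := (s R).
Local Notation w := (Num.sqrt 2 : R).
Local Notation Re := complex.Re.
Local Notation Im := complex.Im.

Lemma ws_bounds : 93 / 100 < w * s < 96 / 100.
Proof. by have := @s_bounds R; have := @sqrt2_bounds R; nra. Qed.

(** At a = 0 these coordinates equal w s / 2 up to sign, between 0.465 and 0.48, and a deviation
    below 1/50 stays inside (2/5, 3/5). *)
Lemma chi_near : \forall a \near (0 : R), 0 <= a ->
  [/\ 2 / 5 < Re (chi1 a) < 3 / 5, 2 / 5 < Im (chi1 a) < 3 / 5,
      2 / 5 < - Re (chi2 a) < 3 / 5 & 2 / 5 < Im (chi2 a) < 3 / 5].
Proof.
have e0 : (0 : R) < 1 / 50 by lra.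
have /andP[b1 b2] := ws_bounds.
near=> a => a0.
have itv (x : R) : `|x - w * s / 2| < 1 / 50 -> 2 / 5 < x < 3 / 5.
  move: b1 b2; move: (w * s) => u b1 b2; rewrite ltr_norml => /andP[? ?].
  by apply/andP; split; lra.
split; apply: itv.
- by move: a0; near: a; exact: jet_near jet_Re_chi1 e0.
- by move: a0; near: a; exact: jet_near jet_Im_chi1 e0.
- rewrite -opprD normrN -[w * s / 2]opprK.
  by move: a0; near: a; exact: jet_near jet_Re_chi2 e0.
- by move: a0; near: a; exact: jet_near jet_Im_chi2 e0.
Unshelve. all: by end_near.
Qed.

(** At a = 0 both differences have coordinates of size w (1 - s) / 2 < 1/4. With 1/50 for each of
    the two points, the sum of the two coordinates stays below 2 (1/4 + 2/50) = 29/50. *)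
Lemma eta_chi_near : \forall a \near (0 : R), 0 <= a ->
  normc (eta_ a - chi1 a) < 3 / 5 /\ normc ('i * eta_ a - chi2 a) < 3 / 5.
Proof.
have e0 : (0 : R) < 1 / 50 by lra.
have /andP[b1 b2] := ws_bounds; have /andP[c1 c2] := @sqrt2_bounds R.
have half (x y : R) : `|x| < 29 / 100 -> `|y| < 29 / 100 -> `|x| + `|y| < 3 / 5.
  by clear; lra.
have wsB : `|w / 2 - w * s / 2| < 1 / 4.
  move: b1 b2 c1 c2; move: (w * s) => u; move: (Num.sqrt (2 : R)) => r.
  by clear=> *; rewrite ltr_norml; apply/andP; split; lra.
have close (x y p q : R) : `|x - p| < 1 / 50 -> `|y - q| < 1 / 50 -> `|p - q| < 1 / 4 ->
    `|x - y| < 29 / 100.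
  by clear; rewrite !ltr_norml => *; apply/andP; split; lra.
have Re_iz (z : R[i]) : Re ('i * z) = - Im z by case: z => x y /=; ring.
have Im_iz (z : R[i]) : Im ('i * z) = Re z by case: z => x y /=; ring.
have ReB (z v : R[i]) : Re (z - v) = Re z - Re v by case: z v => x y [].
have ImB (z v : R[i]) : Im (z - v) = Im z - Im v by case: z v => x y [].
near=> a => a0.
have : `|Re (chi1 a) - w * s / 2| < 1 / 50.
  by move: a0; near: a; exact: jet_near jet_Re_chi1 e0.
have : `|Im (chi1 a) - w * s / 2| < 1 / 50.
  by move: a0; near: a; exact: jet_near jet_Im_chi1 e0.
have : `|Re (chi2 a) - - (w * s / 2)| < 1 / 50.
  by move: a0; near: a; exact: jet_near jet_Re_chi2 e0.
have : `|Im (chi2 a) - w * s / 2| < 1 / 50.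
  by move: a0; near: a; exact: jet_near jet_Im_chi2 e0.
have : `|Re (eta_ a) - w / 2| < 1 / 50.
  by move: a0; near: a; exact: jet_near jet_Re_eta e0.
have : `|Im (eta_ a) - w / 2| < 1 / 50.
  by move: a0; near: a; exact: jet_near jet_Im_eta e0.
move=> hy hx hi2 hr2 hi1 hr1.
split; apply: le_lt_trans (normc_le_ReIm _) _; apply: half;
  rewrite !(ReB, ImB, Re_iz, Im_iz).
- exact: close hx hr1 wsB.
- exact: close hy hi1 wsB.
- rewrite -opprD normrN -[Re (chi2 a)]opprK; apply: close hy _ wsB.
  by rewrite -opprD normrN -[w * s / 2]opprK.
- exact: close hx hi2 wsB.
Unshelve. all: by end_near.
Qed.

(** The disk of radius 2 contains the zeros of [s_ a] for small a, and there z^k is at most 2^k in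
    modulus. *)
Lemma q_deriv_small : exists2 C : R, 0 <= C &
  forall (a : R) (z : R[i]), 0 <= a <= 1 -> normc z <= 2 ->
  normc ((5^-1 *: (q_ a)^`()).[z] - (5^-1 *: s_ a).[z]) <= C * a ^+ 3.
Proof.
have /choice [C HC] := @jet_coef_diff R.
exists (\sum_(k < 4) C k * 2 ^+ k).
  apply: sumr_ge0 => k _; rewrite mulr_ge0 ?exprn_ge0 //.
  by apply: cubic_bound_ge0 (HC k).
move=> a z a01 z2; rewrite q_deriv_sub_s mulr_suml.
apply: le_trans (normc_sum _ _ _) _.
apply: ler_sum => k _; rewrite normcM normc_real mulrAC normcX.
apply: ler_pM => //; first by rewrite exprn_ge0 ?normc_ge0.
  by have := HC k a a01; rewrite !mul0r !addr0 subr0.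
by apply: lerXn2r; rewrite ?nnegrE ?normc_ge0.
Qed.

End SmallParameter.

(** * Location of the critical points and the value of [sendov_d] *)

Section CriticalDistance.
Context {R : realType}.
Local Notation s := (s R).
Local Notation Re := complex.Re.
Local Notation Im := complex.Im.

Lemma q_monic (a : R) : q_ a \is monic.
Proof. by rewrite q_prod monic_prod_XsubC. Qed.

Lemma size_q (a : R) : size (q_ a) = 6.
Proof. by rewrite q_prod size_prod_XsubC. Qed.

(** The four points lie in the four open quadrants with coordinates beyond 2/5 in size, so any two
    differ by more than 4/5 in some coordinate. The bound is written 2 (1/4) to feed
    [Delta_separated_le] with c = 1/4. *)
Lemma s_zeros_separated (a : R) :
  2 / 5 < Re (chi1 a) < 3 / 5 -> 2 / 5 < Im (chi1 a) < 3 / 5 ->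
  2 / 5 < - Re (chi2 a) < 3 / 5 -> 2 / 5 < Im (chi2 a) < 3 / 5 ->
  uniq (s_zeros a) /\
  {in s_zeros a &, forall x y, x != y -> 2 * (1 / 4) <= normc (x - y)}.
Proof.
rewrite /s_zeros; move: (chi1 a) (chi2 a) => [x1 y1] [x2 y2] /=.
move=> /andP[? ?] /andP[? ?] /andP[? ?] /andP[? ?].
have farRe (z v : R[i]) : 2 * (1 / 4) <= Re z - Re v -> 2 * (1 / 4) <= normc (z - v).
  by move=> /le_trans; apply; apply: le_trans (Re_le_normc _);
     case: z v => ? ? [? ?]; exact: ler_norm.
have farIm (z v : R[i]) : 2 * (1 / 4) <= Im z - Im v -> 2 * (1 / 4) <= normc (z - v).
  by move=> /le_trans; apply; apply: le_trans (Im_le_normc _);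
     case: z v => ? ? [? ?]; exact: ler_norm.
have far (z v : R[i]) : [\/ 2 * (1 / 4) <= Re z - Re v, 2 * (1 / 4) <= Re v - Re z,
    2 * (1 / 4) <= Im z - Im v | 2 * (1 / 4) <= Im v - Im z] -> 2 * (1 / 4) <= normc (z - v).
  by case=> ?; [|rewrite normc_distC| |rewrite normc_distC];
    by [exact: farRe|exact: farIm].
have neq (z v : R[i]) : 2 * (1 / 4) <= normc (z - v) -> z != v.
  by apply: contraTN => /eqP ->; rewrite subrr normc0 -ltNge; lra.
have gap (x y : R) : 2 / 5 < x -> 2 / 5 < - y -> 2 * (1 / 4) <= x - y by clear; lra.
split.
  rewrite /= !inE !negb_or !neq //; apply: far => /=; by [constructor 1; apply: gap; rewrite ?opprK
    | constructor 2; apply: gap; rewrite ?opprK | constructor 3; apply: gap; rewrite ?opprK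
    | constructor 4; apply: gap; rewrite ?opprK].
move=> z v; rewrite !inE => /or4P[]/eqP-> /or4P[]/eqP->; rewrite ?eqxx // => _; apply: far => /=;
  by [constructor 1; apply: gap; rewrite ?opprK
    | constructor 2; apply: gap; rewrite ?opprK | constructor 3; apply: gap; rewrite ?opprK
    | constructor 4; apply: gap; rewrite ?opprK].
Qed.

Lemma near_cubic_lt (C e : R) : 0 <= C -> 0 < e ->
  \forall a \near (0 : R), 0 <= a -> C * a ^+ 3 < e.
Proof.
move=> C0 e0; near=> a => a0.
have a1 : a <= 1 by near: a; exact: lt_le_nbhsl.
have : a < e / (C + 1) by near: a; apply: lt_nbhsl; rewrite divr_gt0 ?ltr_wpDl.
rewrite ltr_pdivlMr ?ltr_wpDl // => /(le_lt_trans _); apply.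
have a3 : a ^+ 3 <= a by rewrite exprS ler_piMr // exprn_ile1.
rewrite mulrDr mulr1 mulrC; apply: (@le_trans _ _ (a * C)); first by rewrite ler_wpM2r.
by rewrite lerDl.
Unshelve. all: by end_near.
Qed.

Lemma Delta_deriv_le : exists2 C : R, 0 <= C & \forall a \near (0 : R), 0 <= a ->
  Delta 4 (5^-1 *: (q_ a)^`()) (5^-1 *: s_ a) <= C * a ^+ 3.
Proof.
have le2 (x y : R) : `|x| < 3 / 5 -> `|y| < 3 / 5 -> `|x| + `|y| <= 2 by lra.
have norm_lt (x : R) : 2 / 5 < x < 3 / 5 -> `|x| < 3 / 5 by rewrite ltr_norml; lra.
(* The denominator is c^n of [Delta_separated_le] with c = 1/4 and n = 3; its smallness condition is
   [Ca] below. *)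
have [C C0 HC] := @q_deriv_small R; exists (C / (1 / 4) ^+ 3).
  by rewrite divr_ge0 // exprn_ge0 // divr_ge0.
near=> a => a0.
have a1 : a <= 1 by near: a; exact: lt_le_nbhsl.
have Ca : C * a ^+ 3 < (1 / 4) ^+ 4.
  by move: a0; near: a; apply: near_cubic_lt => //; rewrite exprn_gt0 //; lra.
have [b1 b2 b3 b4] : [/\ 2 / 5 < Re (chi1 a) < 3 / 5, 2 / 5 < Im (chi1 a) < 3 / 5,
    2 / 5 < - Re (chi2 a) < 3 / 5 & 2 / 5 < Im (chi2 a) < 3 / 5].
  by move: a0; near: a; exact: chi_near.
have [us sep] := s_zeros_separated b1 b2 b3 b4.
have [mq sq] := monic_scale_deriv (q_monic a) (size_q a).
rewrite s_prod mulrAC; apply: Delta_separated_le sep _ Ca => //.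
move=> z zs; have z0 : (5^-1 *: s_ a).[z] = 0.
  by apply/eqP; rewrite -/(root _ _) s_prod root_prod_XsubC.
rewrite -[_.[z]]subr0 -z0; apply: HC; first by rewrite a0.
apply: le_trans (normc_le_ReIm _) _.
have norm_conj (v : R[i]) : `|Re v^*%C| + `|Im v^*%C| = `|Re v| + `|Im v|.
  by case: v => x y /=; rewrite normrN.
have n1 : `|Re (chi1 a)| + `|Im (chi1 a)| <= 2 by apply: le2; exact: norm_lt.
have n2 : `|Re (chi2 a)| + `|Im (chi2 a)| <= 2.
  by apply: le2; [rewrite -normrN|]; exact: norm_lt.
by move: zs; rewrite !inE => /or4P[]/eqP->; rewrite ?norm_conj.
Unshelve. all: by end_near.
Qed.

Lemma K_gt0 : 0 < K R.
Proof. by rewrite KE mulr_gt0 ?s_gt0 // ltr_wpDr // mulr_ge0 // sqr_ge0. Qed.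

Lemma dist_s_zeros (a : R) z : z \in s_zeros a ->
  normc (a%:C - z) = s + K R * a ^+ 2.
Proof.
have r0 : 0 <= s + K R * a ^+ 2.
  by rewrite addr_ge0 ?(ltW s_gt0) // mulr_ge0 ?sqr_ge0 // ltW // K_gt0.
have circ (t : R) : normc (a%:C - (a%:C + (s + K R * a ^+ 2)%:C * expi t)) = s + K R * a ^+ 2.
  rewrite opprD addrA subrr sub0r normcN normcM normc_real ger0_norm //.
  by rewrite /= cos2Dsin2 sqrtr1 mulr1.
have conj (v : R[i]) : normc (a%:C - v^*%C) = normc (a%:C - v).
  by rewrite -[RHS]normc_conj rmorphB /= oppr0.
have c1 := circ (pi / 4 + gamma R * a + delta R * a ^+ 2).
have c2 := circ (3 * pi / 4 + gamma R * a - delta R * a ^+ 2).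
by rewrite !inE => /or4P[]/eqP->; rewrite ?conj; [exact: c1|exact: c2|exact: c1|exact: c2].
Qed.

Lemma crit_dist_q_le (a : R) (alpha z : R[i]) : z \in s_zeros a ->
  crit_dist (q_ a) alpha <=
    normc (alpha - z) + Delta 4 (5^-1 *: (q_ a)^`()) (5^-1 *: s_ a).
Proof.
move=> zs; have [mq sq] := monic_scale_deriv (q_monic a) (size_q a).
have ms : 5^-1 *: s_ a \is monic by rewrite s_prod monic_prod_XsubC.
have ss : size (5^-1 *: s_ a) = 5 by rewrite s_prod size_prod_XsubC.
have [_ /(_ z)] := Delta_root mq ms sq ss.
rewrite {1}s_prod root_prod_XsubC => /(_ zs) [v rv dv].
apply: le_trans (crit_dist_le alpha (z := v) _ _) _.
- by apply: contraTneq (monic_neq0 mq) => ->; rewrite scaler0 eqxx.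
- by move: rv; rewrite rootZ // invr_eq0 pnatr_eq0.
apply: le_trans (normc_triangle _ z _) _.
by rewrite lerD2l normc_distC.
Qed.

(** The critical point nearest to a is within [Delta] of some zero of [s_ a]; which one is
    immaterial, as all lie on the same circle about a. *)
Lemma crit_dist_q_ge (a : R) : s + K R * a ^+ 2 <=
  crit_dist (q_ a) a%:C + Delta 4 (5^-1 *: (q_ a)^`()) (5^-1 *: s_ a).
Proof.
have [mq sq] := monic_scale_deriv (q_monic a) (size_q a).
have ms : 5^-1 *: s_ a \is monic by rewrite s_prod monic_prod_XsubC.
have ss : size (5^-1 *: s_ a) = 5 by rewrite s_prod size_prod_XsubC.
have n5 : (5 : R[i])^-1 != 0 by rewrite invr_eq0 pnatr_eq0.
have [z rz ->] : exists2 z, root (q_ a)^`() z & crit_dist (q_ a) a%:C = normc (a%:C - z).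
  by apply: crit_dist_attained; rewrite -(size_scale _ n5) sq.
have [/(_ z) + _] := Delta_root mq ms sq ss.
rewrite rootZ // => /(_ rz) [v rv dv].
rewrite -(@dist_s_zeros a v); last by rewrite -root_prod_XsubC -s_prod.
by apply: le_trans (normc_triangle _ z _) _; rewrite lerD2l.
Qed.

Lemma crit_dist_q_approx : exists2 C : R, 0 <= C & \forall a \near (0 : R), 0 <= a ->
  `|crit_dist (q_ a) a%:C - (s + K R * a ^+ 2)| <= C * a ^+ 3.
Proof.
have [C C0 HC] := Delta_deriv_le; exists C => //; near=> a => a0.
have D : Delta 4 (5^-1 *: (q_ a)^`()) (5^-1 *: s_ a) <= C * a ^+ 3.
  by move: a0; near: a.
have cs : chi1 a \in s_zeros a by exact: mem_head.
have := crit_dist_q_ge a; have := crit_dist_q_le a%:C cs; rewrite dist_s_zeros // => h1 h2.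
by rewrite ler_norml; lra.
Unshelve. all: by end_near.
Qed.

(** Once [Delta] is below 1/50, the zero a has critical distance above 33/50 - 1/50 = 32/50, while
    every other zero has one below 3/5 + 1/50 = 31/50. *)
Lemma sendov_d_q : \forall a \near (0 : R), 0 <= a ->
  sendov_d (q_ a) = crit_dist (q_ a) a%:C.
Proof.
have [C C0 HC] := Delta_deriv_le; have /andP[s1 _] := @s_bounds R.
near=> a => a0.
have D : Delta 4 (5^-1 *: (q_ a)^`()) (5^-1 *: s_ a) <= C * a ^+ 3.
  by move: a0; near: a.
have D' : C * a ^+ 3 < 1 / 50 by move: a0; near: a; apply: near_cubic_lt => //; lra.
have [d1 d2] : normc (eta_ a - chi1 a) < 3 / 5 /\ normc ('i * eta_ a - chi2 a) < 3 / 5.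
  by move: a0; near: a; exact: eta_chi_near.
have perm_q : zeros (q_ a) =i q_zeros a by apply: perm_mem; rewrite q_prod perm_zeros_prod.
have ge : 32 / 50 < crit_dist (q_ a) a%:C.
  have := crit_dist_q_ge a; have : 0 <= K R * a ^+ 2 by rewrite mulr_ge0 ?sqr_ge0 // ltW // K_gt0.
  move: s1 D D'; move: (Delta _ _ _) (crit_dist _ _) s (K R * a ^+ 2) (C * a ^+ 3).
  by clear=> *; lra.
apply/eqP; rewrite eq_le; apply/andP; split; last first.
  by apply/seq_max_ge/map_f; rewrite perm_q mem_head.
apply: seq_max_le => [|x /mapP[z zq ->]].
  by rewrite -size_eq0 size_map size_zeros ?size_q // -size_poly_eq0 size_q.
have far y v : v \in s_zeros a -> normc (y - v) < 3 / 5 ->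
    crit_dist (q_ a) y <= crit_dist (q_ a) a%:C.
  move=> /(crit_dist_q_le y); move: D D' ge; move: (Delta _ _ _) (crit_dist _ a%:C).
  by move: (crit_dist _ y) (normc _) (C * a ^+ 3); clear=> *; lra.
have d1' : normc ((eta_ a)^*%C - (chi1 a)^*%C) < 3 / 5 by rewrite -rmorphB normc_conj.
have d2' : normc (- ('i * (eta_ a)^*%C) - (chi2 a)^*%C) < 3 / 5.
  suff -> : - ('i * (eta_ a)^*%C) = ('i * eta_ a)^*%C by rewrite -rmorphB normc_conj.
  by apply/eqP; rewrite eq_complex /=; apply/andP; split; apply/eqP; ring.
move: zq; rewrite perm_q !inE => /or4P[/eqP->|/eqP->|/eqP->|/orP[]/eqP->] //.
- by apply: far _ d1; rewrite !inE eqxx.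
- by apply: far _ d2; rewrite !inE eqxx ?orbT.
- by apply: far _ d1'; rewrite !inE eqxx ?orbT.
- by apply: far _ d2'; rewrite !inE eqxx ?orbT.
Unshelve. all: by end_near.
Qed.

End CriticalDistance.

(** * Passage to the limit and failure of local maximality *)

Section Conclusion.
Context {R : realType}.
Local Notation Re := complex.Re.
Local Notation Im := complex.Im.

Lemma jet_at0 (f : R -> R) p0 p1 p2 : jet f p0 p1 p2 -> f 0 = p0.
Proof.
move=> [C /(_ 0)]; rewrite lexx ler01 !expr0n !mulr0 !addr0 => /(_ isT).
by rewrite normr_le0 subr_eq0 => /eqP.
Qed.

Lemma q_at0 : q_ (0 : R) = 'X^5 + 'X.
Proof.
have z0 : (0 : R)%:C%:P = 0 :> {poly R[i]} by rewrite rmorph0.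
rewrite q_expand (jet_at0 jet_linc) (jet_at0 jet_quadc) [0 * 0]mul0r !subr0 z0.
by rewrite !mul0r !addr0 rmorph1 mul1r ?subr0.
Qed.

Lemma Delta_q_le : exists2 C : R, 0 <= C &
  forall a : R, 0 <= a <= 1 -> Delta 5 (q_ a) ('X^5 + 'X) <= C * a.
Proof.
have [C C0 HC] := jet_lip (@jet_Re_eta R); have [D D0 HD] := jet_lip (@jet_Im_eta R).
(* The 1 accounts for the zero a moving away from 0. The other four zeros move by the same amount as
   eta, at most (C + D) a, since conjugation and multiplication by i or - i preserve distances. *)
exists (1 + (C + D)); first by rewrite !addr_ge0.
move=> a a01; have /andP[a0 a1] := a01; rewrite -q_at0 !q_prod.
have CDa : 0 <= (C + D) * a by rewrite mulr_ge0 ?addr_ge0.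
have eta_le : normc (eta_ a - eta_ 0) <= (1 + (C + D)) * a.
  apply: le_trans (normc_le_ReIm _) _.
  have -> : Re (eta_ a - eta_ 0) = Re (eta_ a) - Num.sqrt 2 / 2.
    by rewrite -(jet_at0 jet_Re_eta).
  have -> : Im (eta_ a - eta_ 0) = Im (eta_ a) - Num.sqrt 2 / 2.
    by rewrite -(jet_at0 jet_Im_eta).
  have := HC a a01; have := HD a a01; lra.
have i1 : normc ('i : R[i]) = 1 by rewrite /= expr0n expr1n add0r sqrtr1.
have a_le : normc (a%:C - 0%:C : R[i]) <= (1 + (C + D)) * a.
  have -> : a%:C - 0%:C = a%:C :> R[i].
    by apply/eqP; rewrite eq_complex /= !subr0 !eqxx.
  by rewrite normc_real ger0_norm // mulrDl mul1r lerDl.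
have etaJ_le : normc ((eta_ a)^*%C - (eta_ 0)^*%C) <= (1 + (C + D)) * a.
  by rewrite -rmorphB normc_conj.
have ieta_le : normc ('i * eta_ a - 'i * eta_ 0) <= (1 + (C + D)) * a.
  by rewrite -mulrBr normcM i1 mul1r.
have ietaJ_le : normc (- ('i * (eta_ a)^*%C) - - ('i * (eta_ 0)^*%C)) <= (1 + (C + D)) * a.
  by rewrite -opprD normcN -mulrBr normcM i1 mul1r.
by apply: Delta_prod_le => // -[|[|[|[|[|//]]]]] _.
Qed.

Lemma sendov_class_q (a : R) : 0 <= a <= 1 -> sendov_class 5 (q_ a).
Proof.
move=> /andP[a0 a1]; split; [exact: q_monic|exact: size_q|move=> z].
have eta1 : normc (eta_ a) = 1 by rewrite /= cos2Dsin2 sqrtr1.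
have i1 : normc ('i : R[i]) = 1 by rewrite /= expr0n expr1n add0r sqrtr1.
rewrite q_prod root_prod_XsubC !inE => /or4P[/eqP->|/eqP->|/eqP->|/orP[]/eqP->].
- by rewrite normc_real ger0_norm.
- by rewrite eta1.
- by rewrite normcM eta1 i1 mulr1.
- by rewrite normc_conj eta1.
- by rewrite normcN normcM normc_conj eta1 i1 mulr1.
Qed.

(** Estimates are kept over a full neighbourhood with the guard 0 <= a, so that they can be read at
    a = 0; the filter of right neighbourhoods excludes that point. *)
Lemma near_right (P : R -> Prop) :
  (\forall a \near (0 : R), 0 <= a -> P a) -> \forall a \near (0 : R)^'+, P a.
Proof.
move=> H; rewrite /at_right near_withinE; near=> a => /ltW.
by near: a.
Unshelve. all: by end_near.
Qed.

Lemma eqO_right (f g : R -> R) (C : R) :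
  (\forall a \near (0 : R), 0 <= a -> `|f a| <= C * `|g a|) ->
  (f : R -> R^o) =O_ (0^'+) (g : R -> R^o).
Proof.
(* [eqO_exP] asks for a positive constant, while [C] has no prescribed sign. *)
move=> H; apply/eqO_exP; exists (`|C| + 1); first by rewrite ltr_wpDl.
apply: near_right; near=> a => a0.
have : `|f a| <= C * `|g a| by move: a0; near: a.
move=> /le_trans; apply; rewrite ler_wpM2r //.
by apply: le_trans (ler_norm C) _; rewrite lerDl.
Unshelve. all: by end_near.
Qed.

End Conclusion.

Unset Implicit Arguments.

Theorem theorem2p4 (R : realType) :
  `|K R - (5 + 665 / 10 ^+ 3 + 658 / 10 ^+ 6 + 792 / 10 ^+ 9)| < 10 ^- 8 /\
  (forall a : R, 0 <= a <= 1 -> sendov_class 5 (q_ a)) /\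
  (fun a : R => Delta 5 (q_ a) ('X^5 + 'X) : R^o)
    =O_ (0^'+) (fun a : R => a : R^o) /\
  (fun a : R => Delta 4 (5^-1 *: (q_ a)^`()) (5^-1 *: s_ a) : R^o)
    =O_ (0^'+) (fun a : R => a ^+ 3 : R^o) /\
  (\forall a \near (0 : R)^'+, sendov_d (q_ a) = crit_dist (q_ a) a%:C) /\
  (fun a : R => crit_dist (q_ a) a%:C : R^o)
    = (fun a : R => s R + K R * a ^+ 2 : R^o)
      +O_ (0^'+) (fun a : R => a ^+ 3 : R^o) /\
  sendov_class 5 ('X^5 + 'X : {poly R[i]}) /\
  ~ locally_maximal 5 ('X^5 + 'X : {poly R[i]}).
Proof.
have [C1 C10 HD] := @Delta_q_le R; have [C2 C20 HD'] := @Delta_deriv_le R.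
have [C3 C30 Hc] := @crit_dist_q_approx R; have Hd := @sendov_d_q R.
have class0 : sendov_class 5 ('X^5 + 'X : {poly R[i]}).
  by rewrite -q_at0; apply: sendov_class_q; rewrite lexx ler01.
split; first exact: K_approx.
split; first exact: sendov_class_q.
split.
  apply: (@eqO_right _ _ _ C1); near=> a => a0.
  rewrite ger0_norm ?Delta_ge0 // (ger0_norm a0) HD // a0 /=.
  by near: a; exact: lt_le_nbhsl.
split.
  apply: (@eqO_right _ _ _ C2); near=> a => a0.
  rewrite ger0_norm ?Delta_ge0 // (ger0_norm (exprn_ge0 3 a0)).
  by move: a0; near: a.
split; first exact: near_right.
split.
  apply/eqaddOP/eqOP/(@eqO_right _ _ _ C3); near=> a => a0.
  rewrite (ger0_norm (exprn_ge0 3 a0)).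
  by move: a0; near: a.
split=> // -[_ [e e0 He]].
(* A property that holds near 0 holds at 0; there the polynomial is z^5 + z and the cubic error
   vanishes. *)
have d0 : sendov_d ('X^5 + 'X : {poly R[i]}) = s R.
  have := nbhs_singleton Hc (lexx 0); rewrite -q_at0 (nbhs_singleton Hd (lexx 0)).
  by rewrite !expr0n !mulr0 addr0 normr_le0 subr_eq0 => /eqP.
have K0 := @K_gt0 R.
near (0 : R)^'+ => a.
have a0 : 0 < a by near: a; exact: nbhs_right_gt.
have a1 : a <= 1 by near: a; exact: nbhs_right_le.
(* This choice puts [q_ a] within [e] of z^5 + z. The next one makes the error C3 a^3 smaller than
   the gain K a^2. Adding 1 keeps the divisors positive. *)
have aC1 : a * (C1 + 1) < e.
  by rewrite -ltr_pdivlMr ?ltr_wpDl //; near: a; apply: nbhs_right_lt; rewrite divr_gt0 ?ltr_wpDl.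
have aC3 : a * (C3 + 1) < K R.
  by rewrite -ltr_pdivlMr ?ltr_wpDl //; near: a; apply: nbhs_right_lt; rewrite divr_gt0 ?ltr_wpDl.
have da : sendov_d (q_ a) = crit_dist (q_ a) a%:C.
  by near: a; exact: near_right.
have ca : `|crit_dist (q_ a) a%:C - (s R + K R * a ^+ 2)| <= C3 * a ^+ 3.
  by near: a; exact: near_right.
have a01 : 0 <= a <= 1 by rewrite ltW.
have /He : Delta 5 (q_ a) ('X^5 + 'X) < e.
  by apply: le_lt_trans (HD a a01) _; move: aC1; rewrite mulrDr mulr1 mulrC; lra.
rewrite d0 da => /(_ (sendov_class_q a01)); apply/negP; rewrite -ltNge.
move: ca; rewrite ler_norml => /andP[ca _].
have : C3 * a ^+ 3 < K R * a ^+ 2.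
  by rewrite exprS mulrA ltr_pM2r ?exprn_gt0 //; move: aC3; rewrite mulrDr mulr1 mulrC; lra.
lra.
Unshelve. all: by end_near.
Qed.
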